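(* Let $k$ be a non-negative integer, and let $(g_1,\dots,g_n)$ be an $n$-tuple of elements of $SL(2,\mathbb{Z})$ each of which is a conjugate of $s_1$ in $SL(2,\mathbb{Z})$. (1) If $g_1\cdots g_n=s_1^k$ in $SL(2,\mathbb{Z})$, then $p:=(n-k)/12$ is a non-negative integer and $(g_1,\dots,g_n)$ can be changed to $(s_1,s_2)^{6p}\cdot(s_1)^k$ by elementary transformations. (2) If $g_1\cdots g_n=(s_1s_2)^3s_1^k$ in $SL(2,\mathbb{Z})$, then $p:=(n-6-k)/12$ is a non-negative integer and $(g_1,\dots,g_n)$ can be changed to $(s_1,s_2)^{6p+3}\cdot(s_1)^k$ by elementary transformations.
   Context: Here $$s_1=\begin{pmatrix}1&0\\1&1\end{pmatrix},\qquad s_2=\begin{pmatrix}1&-1\\0&1\end{pmatrix}\in SL(2,\mathbb{Z}).$$ Elementary transformations (Hurwitz moves) of a tuple $(g_1,\dots,g_n)$ of group elements replace a consecutive pair $(g_i,g_{i+1})$ by $(g_{i+1},\,g_{i+1}^{-1}g_ig_{i+1})$ or by $(g_ig_{i+1}g_i^{-1},\,g_i)$, leaving the other entries unchanged; ''can be changed by elementary transformations'' means by a finite sequence of these. Notation: $(a_1,\dots,a_r)\cdot(b_1,\dots,b_m):=(a_1,\dots,a_r,b_1,\dots,b_m)$ is concatenation of tuples, and $(a_1,\dots,a_r)^m$ is the concatenation of $m$ copies of $(a_1,\dots,a_r)$. *)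

(* Defs.v *)
From HB Require Import structures.
From mathcomp Require Import all_boot all_order all_algebra all_fingroup.
From Stdlib Require Import Relation_Operators.

Set Implicit Arguments.
Unset Strict Implicit.
Unset Printing Implicit Defensive.

Import GRing.Theory.
Local Open Scope ring_scope.

Record SL2Z := SL2 { SL2_mx :> 'M[int]_2; SL2_det : \det SL2_mx == 1 }.

HB.instance Definition _ := [isSub for SL2_mx].
HB.instance Definition _ := [Choice of SL2Z by <:].

Lemma SL2_one_subproof : \det (1%:M : 'M[int]_2) == 1.
Proof. by rewrite det1. Qed.

Lemma SL2_mul_subproof (A B : SL2Z) : \det (A *m B : 'M[int]_2) == 1.
Proof. by rewrite det_mulmx (eqP (SL2_det A)) (eqP (SL2_det B)) mulr1. Qed.

Lemma SL2_inv_subproof (A : SL2Z) : \det (invmx A : 'M[int]_2) == 1.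
Proof. by rewrite det_inv (eqP (SL2_det A)) invr1. Qed.

Definition SL2_one : SL2Z := SL2 SL2_one_subproof.
Definition SL2_mul (A B : SL2Z) : SL2Z := SL2 (SL2_mul_subproof A B).
Definition SL2_inv (A : SL2Z) : SL2Z := SL2 (SL2_inv_subproof A).

Lemma SL2_unitmx (A : SL2Z) : (A : 'M[int]_2) \in unitmx.
Proof. by rewrite unitmxE (eqP (SL2_det A)) unitr1. Qed.

Lemma SL2_mulA : associative SL2_mul.
Proof. by move=> A B C; apply/val_inj/mulmxA. Qed.

Lemma SL2_mul1 : left_id SL2_one SL2_mul.
Proof. by move=> A; apply/val_inj/mul1mx. Qed.

Lemma SL2_mulr1 : right_id SL2_one SL2_mul.
Proof. by move=> A; apply/val_inj/mulmx1. Qed.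

Lemma SL2_mulV : left_inverse SL2_one SL2_inv SL2_mul.
Proof. by move=> A; apply/val_inj/mulVmx/SL2_unitmx. Qed.

Lemma SL2_mulrV : right_inverse SL2_one SL2_inv SL2_mul.
Proof. by move=> A; apply/val_inj/mulmxV/SL2_unitmx. Qed.

HB.instance Definition _ := isGroup.Build SL2Z
  SL2_mulA SL2_mul1 SL2_mulr1 SL2_mulV SL2_mulrV.

Definition mx22 (a b c d : int) : 'M[int]_2 :=
  \matrix_(i, j) nth 0 (nth [::] [:: [:: a; b]; [:: c; d]] i) j.

Lemma det_mx22E (a b c d : int) : \det (mx22 a b c d) = a * d - b * c.
Proof.
rewrite (expand_det_row _ ord0) !big_ord_recl big_ord0 /cofactor !det_mx11.
by rewrite !mxE /= expr0 expr1 mul1r mulN1r mulrN addr0.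
Qed.

Lemma s1_subproof : \det (mx22 1 0 1 1) == 1.
Proof. by rewrite det_mx22E. Qed.

Lemma s2_subproof : \det (mx22 1 (-1) 0 1) == 1.
Proof. by rewrite det_mx22E. Qed.

Definition s1 : SL2Z := SL2 s1_subproof.
Definition s2 : SL2Z := SL2 s2_subproof.

Local Open Scope group_scope.

Definition conjugate_of (G : groupType) (x y : G) : Prop :=
  exists h : G, x = h^-1 * y * h.

Inductive hurwitz_move (G : groupType) : seq G -> seq G -> Prop :=
  | HurwitzR (l r : seq G) (a b : G) :
      hurwitz_move (l ++ [:: a; b] ++ r) (l ++ [:: b; b^-1 * a * b] ++ r)
  | HurwitzL (l r : seq G) (a b : G) :
      hurwitz_move (l ++ [:: a; b] ++ r) (l ++ [:: a * b * a^-1; a] ++ r).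

Definition hurwitz_reach (G : groupType) : seq G -> seq G -> Prop :=
  clos_refl_trans _ (@hurwitz_move G).

Definition tuple_pow (T : Type) (s : seq T) (m : nat) : seq T :=
  flatten (nseq m s).

(* Main.v *)
(** Modulo its centre, SL(2,Z) is the free product of Z/3 = <rho> and
    Z/2 = <om>, with rho = s1 s2 and om = s1 s2 s1.  Each conjugate of s1 is
    rho om^-1 rho conjugated by a reduced word Q; its depth is the number of
    om's in Q, and depth 0 gives the three elements s1, s2, s2^-1 s1 s2.
    If Q cancels past the middle om of a neighbour, a Hurwitz move lowers the
    depth of that entry; if two neighbours of depth 0 have product rho, they can
    be turned into (s1,s2) and moved to the front at the cost of conjugating the
    other entries by rho, which preserves depths.  This terminates with
    (s1,s2)^m followed by a tuple in which no such cancellation remains.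
    Ping-pong on the projective line then shows that the product of this
    remaining tuple is so close to a reduced word that it can equal
    +-rho^-m s1^k with k >= 0 only if all its entries are s1 and rho^m = +-1. *)

Require Import Defs.
From HB Require Import structures.
From mathcomp Require Import all_boot all_order all_algebra all_fingroup.
From mathcomp Require Import zify.
From Stdlib Require Import Relation_Operators.

Set Implicit Arguments.
Unset Strict Implicit.
Unset Printing Implicit Defensive.

Import Order.TTheory GRing.Theory Num.Theory.
Local Open Scope group_scope.

(** * Sectors of the projective line *)

Lemma mx22_mul (a b c d a' b' c' d' : int) :
  (mx22 a b c d *m mx22 a' b' c' d' =
   mx22 (a * a' + b * c') (a * b' + b * d') (c * a' + d * c') (c * b' + d * d'))%R.
Proof.
apply/matrixP=> i j; rewrite !mxE !big_ord_recl big_ord0 !mxE addr0.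
by case: i j => [[|[|//]] ?] [[|[|//]] ?].
Qed.

Lemma SL2_mx_mul (A B : SL2Z) : SL2_mx (A * B) = (SL2_mx A *m SL2_mx B)%R.
Proof. by []. Qed.

Lemma SL2_mx_inj : injective SL2_mx.
Proof. exact: val_inj. Qed.

Lemma SL2_mx22 (E : SL2Z) : exists a b c d : int,
  SL2_mx E = mx22 a b c d /\ (a * d - b * c = 1)%R.
Proof.
exists (SL2_mx E 0 0)%R, (SL2_mx E 0 1)%R, (SL2_mx E 1 0)%R, (SL2_mx E 1 1)%R.
have eqE : SL2_mx E = mx22 (SL2_mx E 0 0)%R (SL2_mx E 0 1)%R
                           (SL2_mx E 1 0)%R (SL2_mx E 1 1)%R.
  apply/matrixP=> i j; rewrite !mxE.
  by case: i j => [[|[|//]] i] [[|[|//]] j] /=; congr (SL2_mx E _ _); apply/val_inj.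
by split=> //; rewrite -det_mx22E -eqE (eqP (SL2_det E)).
Qed.

Lemma SL2_col_neq0 (a b c d : int) :
  (a * d - b * c = 1)%R -> (a != 0)%R || (c != 0)%R.
Proof. by case: eqVneq => // ->; case: eqVneq => // ->; rewrite mul0r mulr0. Qed.

HB.lock Definition rho : SL2Z := s1 * s2.
HB.lock Definition om : SL2Z := s1 * s2 * s1.
(** This is minus the identity; it collects the signs and drops out of conjugations and sectors. *)
HB.lock Definition z : SL2Z := om * om.

Lemma mx_rho : SL2_mx rho = mx22 1 (-1) 1 0.
Proof. by rewrite rho.unlock SL2_mx_mul /= mx22_mul. Qed.

Lemma mx_om : SL2_mx om = mx22 0 (-1) 1 0.
Proof. by rewrite om.unlock -rho.unlock SL2_mx_mul mx_rho /= mx22_mul. Qed.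

Lemma mx_z : SL2_mx z = mx22 (-1) 0 0 (-1).
Proof. by rewrite z.unlock SL2_mx_mul mx_om mx22_mul. Qed.

Lemma rho3 : rho ^+ 3 = z.
Proof.
rewrite !expgS expg0 mulg1; apply/SL2_mx_inj.
by rewrite !(mx_z, mx_rho, SL2_mx_mul) !mx22_mul.
Qed.

Lemma zC E : commute z E.
Proof.
apply/SL2_mx_inj; have [a [b [c [d [eqE _]]]]] := SL2_mx22 E.
rewrite !(mx_z, eqE, SL2_mx_mul) !mx22_mul.
by rewrite !(mulN1r, mulrN1, mul0r, mulr0, add0r, addr0).
Qed.

Lemma zz : z * z = 1.
Proof.
apply/SL2_mx_inj; rewrite !(mx_z, SL2_mx_mul) mx22_mul.
by apply/matrixP=> i j; rewrite !mxE; case: i j => [[|[|//]] ?] [[|[|//]] ?].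
Qed.

Lemma z_neq1 : z != 1.
Proof.
apply/eqP=> /(congr1 (fun E : SL2Z => SL2_mx E 0 0)%R).
by rewrite mx_z !mxE.
Qed.

(* With e = (0,1), f = (1,0), h = (1,1), the labels 0, 1, 2 stand for the arcs
   [e,f), [f,h), [h,e) of the real projective line; [sector E] locates the first
   column of E.  rho permutes the arcs cyclically and om exchanges arc 0 with
   the union of the other two. *)
Definition sector (E : SL2Z) : 'Z_3 :=
  let a := (SL2_mx E 0 0)%R in let c := (SL2_mx E 1 0)%R in
  (if (0 < a) && (a <= c) || (a < 0) && (c <= a) then 2%:R
   else if (0 < a) && (0 <= c) || (a < 0) && (c <= 0) then 1 else 0)%R.

Lemma sector_rho E : sector (rho * E) = (sector E + 1)%R.
Proof.
have [a [b [c [d [eqE /SL2_col_neq0 ac0]]]]] := SL2_mx22 E.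
rewrite /sector !(mx_rho, eqE, SL2_mx_mul) mx22_mul !mxE /=.
by apply/eqP; (do !case: ifP) => //; lia.
Qed.

Lemma sector_om_neq0 E : sector E != 0%R -> sector (om * E) = 0%R.
Proof.
have [a [b [c [d [eqE /SL2_col_neq0 ac0]]]]] := SL2_mx22 E.
rewrite /sector !(mx_om, eqE, SL2_mx_mul) mx22_mul !mxE /=.
by move=> h; apply/eqP; move: h; (do !case: ifP) => //; lia.
Qed.

Lemma sector_z E : sector (z * E) = sector E.
Proof.
have [a [b [c [d [eqE /SL2_col_neq0 ac0]]]]] := SL2_mx22 E.
rewrite /sector !(mx_z, eqE, SL2_mx_mul) mx22_mul !mxE /=.
by apply/eqP; (do !case: ifP) => //; lia.
Qed.

Lemma s1E : s1 = z * (rho ^+ 2 * om).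
Proof.
rewrite expgS expg1; apply/SL2_mx_inj.
by rewrite !(mx_z, mx_rho, mx_om, SL2_mx_mul) !mx22_mul.
Qed.

Lemma s2E : s2 = z * (om * rho ^+ 2).
Proof.
rewrite expgS expg1; apply/SL2_mx_inj.
by rewrite !(mx_z, mx_rho, mx_om, SL2_mx_mul) !mx22_mul.
Qed.

Lemma sector_1 : sector 1 = 1%R.
Proof. by rewrite /sector !mxE. Qed.

(** The first column of [om] is e, which [s1] fixes. *)
Lemma sector_s1X_om k : sector (s1 ^+ k * om) = 0%R.
Proof.
suff eqE : SL2_mx (s1 ^+ k * om) = mx22 0 (-1) 1 (- k%:Z)%R.
  by rewrite /sector eqE !mxE.
elim: k => [|k IHk]; first by rewrite expg0 mul1g mx_om.
by rewrite expgS -mulgA SL2_mx_mul IHk /= mx22_mul; congr mx22; lia.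
Qed.

Lemma sector_rhoX n E : sector (rho ^+ n * E) = (sector E + n%:R)%R.
Proof.
elim: n => [|n IHn]; first by rewrite expg0 mul1g addr0.
by rewrite expgS -mulgA sector_rho IHn -addrA natr1.
Qed.

Lemma sector_omK E : sector (om * E) != 0%R -> sector E = 0%R.
Proof. by move=> h; apply/eqP/negPn/negP => /sector_om_neq0/eqP; apply/negP. Qed.

Lemma sector_s1 E : sector E != 0%R -> sector (s1 * E) = 2%:R%R.
Proof.
by move=> h; rewrite s1E -mulgA sector_z -mulgA sector_rhoX sector_om_neq0 ?add0r.
Qed.

Lemma sector_s1X k E : sector E != 0%R -> sector (s1 ^+ k.+1 * E) = 2%:R%R.
Proof.
move=> h; elim: k => [|k IHk]; first by rewrite expg1 sector_s1.
by rewrite expgS -mulgA sector_s1 ?IHk.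
Qed.

Lemma conj_z (E A : SL2Z) : E ^ (z * A) = E ^ A.
Proof. by rewrite conjgM (_ : E ^ z = E) // conjgE -zC mulKg. Qed.


Lemma omV : om^-1 = z * om.
Proof. by apply: (mulgI om); rewrite mulgV mulgA -zC -mulgA -z.unlock zz. Qed.

Lemma s1V : s1^-1 = z * (om * rho).
Proof.
apply: (mulgI s1); rewrite mulgV; apply/SL2_mx_inj.
rewrite !(mx_z, mx_rho, mx_om, SL2_mx_mul) /= !mx22_mul.
by apply/matrixP=> i j; rewrite !mxE; case: i j => [[|[|//]] ?] [[|[|//]] ?].
Qed.

Lemma s2V : s2^-1 = z * (rho * om).
Proof.
apply: (mulgI s2); rewrite mulgV; apply/SL2_mx_inj.
rewrite !(mx_z, mx_rho, mx_om, SL2_mx_mul) /= !mx22_mul.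
by apply/matrixP=> i j; rewrite !mxE; case: i j => [[|[|//]] ?] [[|[|//]] ?].
Qed.

Lemma mx_s1V : SL2_mx s1^-1 = mx22 1 0 (-1) 1.
Proof. by rewrite s1V !(mx_z, mx_rho, mx_om, SL2_mx_mul) !mx22_mul. Qed.

Lemma mx_s2V : SL2_mx s2^-1 = mx22 1 1 0 1.
Proof. by rewrite s2V !(mx_z, mx_rho, mx_om, SL2_mx_mul) !mx22_mul. Qed.

Lemma SL2_upper_diag (E : SL2Z) (a b d : int) : SL2_mx E = mx22 a b 0 d ->
  (a = 1 /\ d = 1)%R \/ (a = -1 /\ d = -1)%R.
Proof.
move=> eqE; have /eqP := SL2_det E; rewrite eqE det_mx22E mulr0 subr0 => ad1.
have := congr1 absz ad1; rewrite abszM => /eqP; rewrite muln_eq1.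
case/andP=> /eqP absa _; have [a1|a1] : (a = 1 \/ a = -1)%R by lia.
  by left; move: ad1; rewrite a1; lia.
by right; move: ad1; rewrite a1; lia.
Qed.

(** * Generation by rho and om *)

Section Generation.

Variable K : SL2Z -> Prop.
Hypotheses (K1 : K 1) (Krho : forall E, K E -> K (rho * E))
  (Kom : forall E, K E -> K (om * E)).

Let Kz E : K E -> K (z * E).
Proof. by move=> KE; rewrite z.unlock -mulgA; apply/Kom/Kom. Qed.

Let Ks1 E : K (s1 * E) -> K E.
Proof.
by move=> KE; rewrite -(mulKg s1 E) s1V -!mulgA; apply/Kz/Kom/Krho.
Qed.

Let Ks2 E : K (s2 * E) -> K E.
Proof.
by move=> KE; rewrite -(mulKg s2 E) s2V -!mulgA; apply/Kz/Krho/Kom.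
Qed.

Let Ks1V E : K (s1^-1 * E) -> K E.
Proof.
move=> KE; rewrite -(mulKVg s1 E) {1}s1E expgS expg1 -3!mulgA.
by apply/Kz/Krho/Krho/Kom.
Qed.

Let Ks2V E : K (s2^-1 * E) -> K E.
Proof.
move=> KE; rewrite -(mulKVg s2 E) {1}s2E expgS expg1 -3!mulgA.
by apply/Kz/Kom/Krho/Krho.
Qed.

Let KomV E : K (om * E) -> K E.
Proof. by move=> KE; rewrite -(mulKg om E) omV -mulgA; apply/Kz/Kom. Qed.

Let K_upper (n : nat) (a b d : int) E :
  SL2_mx E = mx22 a b 0 d -> (`|b| <= n)%N -> K E.
Proof.
elim: n b E => [|n IHn] b E eqE leb.
  have b0 : b = 0%R by lia.
  have [[a1 d1]|[a1 d1]] := SL2_upper_diag eqE.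
    rewrite (_ : E = 1) //; apply/SL2_mx_inj; rewrite eqE a1 b0 d1.
    by apply/matrixP=> i j; rewrite !mxE; case: i j => [[|[|//]] ?] [[|[|//]] ?].
  rewrite (_ : E = z * 1); first exact: Kz.
  by rewrite mulg1; apply/SL2_mx_inj; rewrite eqE a1 b0 d1 mx_z.
have [b0|b0] := eqVneq b 0%R; first by apply: (IHn b) => //; rewrite b0.
(* Since d is 1 or -1, its sign relative to b decides which of [s2] and its inverse shortens b. *)
have [bd|bd] : (b * d > 0)%R \/ (b * d < 0)%R.
  by case: (SL2_upper_diag eqE) => -[_ ->]; lia.
  apply: Ks2; apply: (IHn (b - d)%R); last first.
    by case: (SL2_upper_diag eqE) => -[_ d1]; rewrite d1 in bd *; lia.
  by rewrite SL2_mx_mul eqE /= mx22_mul; congr mx22; lia.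
apply: Ks2V; apply: (IHn (b + d)%R); last first.
  by case: (SL2_upper_diag eqE) => -[_ d1]; rewrite d1 in bd *; lia.
by rewrite SL2_mx_mul eqE mx_s2V mx22_mul; congr mx22; lia.
Qed.

(** Euclid's algorithm on the first column (a, c): [s1], [s2] and their inverses, all words in [rho]
    and [om], shrink it until an entry vanishes. If that entry is a, [om] moves the zero to the
    bottom; [K_upper] finishes. *)
Lemma SL2_ind E : K E.
Proof.
have [a [b [c [d [eqE _]]]]] := SL2_mx22 E.
have [n] : exists n, (`|a| + `|c| <= n)%N by exists (`|a| + `|c|)%N.
elim: n a b c d E eqE => [|n IHn] a b c d E eqE le_ac.
  by apply: (@K_upper `|b| a b d) => //; rewrite eqE; congr mx22; lia.
case: (eqVneq c 0%R) => [c0|c0].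
  by apply: (@K_upper `|b| a b d) => //; rewrite eqE; congr mx22.
case: (eqVneq a 0%R) => [a0|a0].
  apply: KomV; apply: (@K_upper `|d| (- c)%R (- d)%R b); last by lia.
  by rewrite SL2_mx_mul eqE mx_om mx22_mul; congr mx22; lia.
case: (ltP 0%R (a * c)%R) => ac; case: (leqP `|c| `|a|) => le.
- apply: Ks2; apply: (IHn (a - c)%R (b - d)%R c d); last by nia.
  by rewrite SL2_mx_mul eqE /= mx22_mul; congr mx22; lia.
- apply: Ks1V; apply: (IHn a b (c - a)%R (d - b)%R); last by nia.
  by rewrite SL2_mx_mul eqE mx_s1V mx22_mul; congr mx22; lia.
- apply: Ks2V; apply: (IHn (a + c)%R (b + d)%R c d); last by nia.
  by rewrite SL2_mx_mul eqE mx_s2V mx22_mul; congr mx22; lia.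
- apply: Ks1; apply: (IHn a b (c + a)%R (d + b)%R); last by nia.
  by rewrite SL2_mx_mul eqE /= mx22_mul; congr mx22; lia.
Qed.

End Generation.

(** * Codes for the conjugates of s1 *)

HB.lock Definition s0 : SL2Z := s1 ^ rho.

Lemma s0E : s0 = z * (rho * om * rho).
Proof.
by rewrite s0.unlock conjgE s1E expgS expg1 -!mulgA (mulgA _ z) -zC -mulgA mulKg.
Qed.

Lemma conj_zl (E A B : SL2Z) : E ^ (A * z * B) = E ^ (A * B).
Proof. by rewrite -zC -mulgA conj_z. Qed.

Lemma s0_rho2 : s0 ^ (rho ^+ 2) = s1.
Proof. by rewrite s0.unlock -conjgM -expgS rho3 -[z]mulg1 conj_z conjg1. Qed.

Lemma s0_rho : s0 ^ rho = s2.
Proof.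
rewrite conjgE s0E s2E expgS expg1 -!mulgA !(mulgA _ z) -zC -mulgA.
by congr (_ * _); rewrite mulKg.
Qed.

Lemma s2_om : s2 ^ om = s1.
Proof. by rewrite conjgE s2E s1E -!mulgA (mulgA _ z) -zC -mulgA mulKg. Qed.

Lemma s1_om : s1 ^ om = s2.
Proof. by rewrite -s2_om -conjgM -z.unlock -[z]mulg1 conj_z conjg1. Qed.

Lemma conj_rhoX (E A B : SL2Z) m n : m = n %[mod 3] ->
  E ^ (A * rho ^+ m * B) = E ^ (A * rho ^+ n * B).
Proof.
suff red k : E ^ (A * rho ^+ k * B) = E ^ (A * rho ^+ (k %% 3) * B).
  by move=> mn; rewrite red mn -red.
rewrite {1}(divn_eq k 3) expgD mulnC expgM rho3.
elim: (k %/ 3) => [|q IHq]; first by rewrite expg0 mul1g.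
by rewrite -IHq expgS -!mulgA (mulgA A) conj_zl.
Qed.

(* A code (c, None) stands for one of the conjugates s0, s2, s1 (c = 0, 1, 2),
   fixing h, f, e respectively; (c, Some X) stands for s0 conjugated by the
   reduced word wd X * om * rho^c.  The head of X is the rightmost syllable of
   wd X. *)
Definition code := ('Z_3 * option (seq bool))%type.

Fixpoint wd (X : seq bool) : SL2Z :=
  if X is a :: X' then wd X' * (om * rho ^+ a.+1) else 1.

Definition cf (x : code) : SL2Z :=
  if x.2 is Some X then wd X * om * rho ^+ x.1 else rho ^+ x.1.

Definition cval (x : code) : SL2Z := s0 ^ cf x.

Definition depth (x : code) : nat := if x.2 is Some X then (size X).+1 else 0.

Lemma wd_cat X Y : wd (X ++ Y) = wd Y * wd X.
Proof. by elim: X => [|a X IHX] /=; rewrite ?mulg1 ?IHX ?mulgA. Qed.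

Lemma Z3_nat (c : 'Z_3) n : ((c + n%:R)%R : nat) = c + n %[mod 3].
Proof. by rewrite /= val_Zp_nat // modn_mod modnDmr. Qed.

Lemma conj_Zp3 (E A B : SL2Z) (c : 'Z_3) n :
  E ^ (A * rho ^+ (c + n%:R)%R * B) = E ^ (A * rho ^+ c * rho ^+ n * B).
Proof.
by rewrite -[A * rho ^+ c * _]mulgA -expgD; apply: conj_rhoX; apply: Z3_nat.
Qed.

(** This serves twice: some bound for every E shows that codes reach all conjugates of [s1], and
    explicit bounds give the drop of depth in a Hurwitz move. *)
Definition conj_bound (N : nat) (E : SL2Z) : Prop :=
  forall x, exists2 y, cval y = cval x ^ E & (depth y <= N + depth x)%N.

Lemma conj_bound1 : conj_bound 0 1.
Proof. by move=> x; exists x; rewrite ?conjg1. Qed.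

Lemma conj_boundM m n E F :
  conj_bound m E -> conj_bound n F -> conj_bound (m + n) (E * F).
Proof.
move=> bE bF x; have [y yE le_y] := bE x; have [t tE le_t] := bF y.
by exists t; [rewrite tE yE conjgM | lia].
Qed.

Lemma conj_bound_rho n : conj_bound 0 (rho ^+ n).
Proof.
move=> [c [X|]];
  [exists ((c + n%:R)%R, Some X) | exists ((c + n%:R)%R, None)] => //.
  by have := conj_Zp3 s0 (wd X * om) 1 c n;
    rewrite !mulg1 [_ ^ (_ * _ ^+ n)]conjgM.
by have := conj_Zp3 s0 1 1 c n; rewrite !mul1g !mulg1 [_ ^ (_ * _ ^+ n)]conjgM.
Qed.

Lemma conj_bound_om : conj_bound 1 om.
Proof.
move=> [c [X|]]; rewrite /cval /cf /=; last first.
  have {c}[->|[->|->]] : c = 0%R \/ c = 1%R \/ c = 2%:R%R.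
  - case: c => [[|[|[|//]]] ?]; [left|right;left|right;right]; exact/val_inj.
  - by exists (0%R, Some [::]); rewrite // /cval /cf /= expg0 mul1g mulg1 conjg1.
  - by exists (2%:R%R, None); rewrite // /cval /cf s0_rho2 expg1 s0_rho s2_om.
  - by exists (1%R, None); rewrite // /cval /cf s0_rho2 expg1 s0_rho s1_om.
(* If c = 0, the new [om] meets the last one and the two form the central [z]; otherwise
   [om * rho ^+ c] becomes a new head syllable. *)
have [c0|c0] := eqVneq c 0%R.
  rewrite c0 expg0 mulg1 -conjgM -mulgA -z.unlock -zC conj_z.
  case: X => [|a X] /=.
    by exists (0%R, None); rewrite // /cval /cf expg0 conjg1.
  exists ((a.+1)%:R%R, Some X); last by rewrite /depth /=; lia.
  by rewrite /cval /cf /= mulgA; case: a.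
exists (0%R, Some ((c == 2%:R)%R :: X)); last by rewrite /depth /=; lia.
rewrite /cval /cf /= -conjgM expg0 mulg1 !mulgA; congr (_ ^ (_ * _ * _)).
by case: c c0 => [[|[|[|//]]] ?].
Qed.

Lemma conj_bound_wd X : conj_bound (size X) (wd X).
Proof.
elim: X => [|a X IHX] /=; first exact: conj_bound1.
rewrite -addn1 -[X in (_ + X)%N]addn0; apply: conj_boundM => //.
by apply: conj_boundM; [apply: conj_bound_om | apply: conj_bound_rho].
Qed.

Lemma conj_bound_cf x : conj_bound (depth x) (cf x).
Proof.
case: x => c [X|]; last exact: conj_bound_rho.
rewrite /depth /cf /= -addn1 -[X in conj_bound X]addn0.
apply: conj_boundM; last exact: conj_bound_rho.
by apply: conj_boundM; [apply: conj_bound_wd | apply: conj_bound_om].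
Qed.

Lemma cval_surj (g : SL2Z) : conjugate_of g s1 -> exists x, cval x = g.
Proof.
case=> h ->; rewrite -mulgA -conjgE.
have [N bh] : exists N, conj_bound N h.
  elim/SL2_ind: h => [|E [N bE]|E [N bE]].
  - by exists 0; apply: conj_bound1.
  - exists (0 + N); rewrite -[rho]expg1.
    by apply: conj_boundM => //; apply: conj_bound_rho.
  - by exists (1 + N); apply: conj_boundM => //; apply: conj_bound_om.
have [y yE _] := bh (2%:R, None)%R; by exists y; rewrite yE /cval /cf s0_rho2.
Qed.

(** * Hurwitz moves *)

Section Hurwitz.

Variable G : groupType.
Implicit Types (s t u l r : seq G) (a b : G).

Lemma hurwitz_trans s t u :
  hurwitz_reach s t -> hurwitz_reach t u -> hurwitz_reach s u.
Proof. exact: rt_trans. Qed.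

Lemma hurwitz_ctx l r s t :
  hurwitz_reach s t -> hurwitz_reach (l ++ s ++ r) (l ++ t ++ r).
Proof.
elim=> {s t} [s t mv|s|s t u _ ? _]; last exact: hurwitz_trans.
  apply: rt_step; case: mv => l' r' a b.
    have := HurwitzR (l ++ l') (r' ++ r) a b.
    by rewrite -!catA.
  have := HurwitzL (l ++ l') (r' ++ r) a b.
  by rewrite -!catA.
exact: rt_refl.
Qed.

Lemma hurwitz_catl l s t : hurwitz_reach s t -> hurwitz_reach (l ++ s) (l ++ t).
Proof. by move=> /(hurwitz_ctx l [::]); rewrite !cats0. Qed.

Lemma hurwitz_catr r s t : hurwitz_reach s t -> hurwitz_reach (s ++ r) (t ++ r).
Proof. exact: (hurwitz_ctx [::]). Qed.

Lemma hurwitz_right a b : hurwitz_reach [:: a; b] [:: b; a ^ b].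
Proof.
by apply: rt_step; have := HurwitzR [::] [::] a b; rewrite conjgE mulgA.
Qed.

Lemma hurwitz_left a b : hurwitz_reach [:: a; b] [:: b ^ a^-1; a].
Proof.
by apply: rt_step; have := HurwitzL [::] [::] a b; rewrite conjgE invgK mulgA.
Qed.

Lemma hurwitz_size s t : hurwitz_reach s t -> size s = size t.
Proof.
elim=> // [x y [] l r a b|x y w _ -> _ ->] //; by rewrite !size_cat.
Qed.

Lemma hurwitz_prod s t : hurwitz_reach s t ->
  \prod_(a <- s) a = \prod_(a <- t) a.
Proof.
elim=> // [x y [] l r a b|x y w _ -> _ ->] //; rewrite !big_cat !big_cons big_nil.
  by rewrite /= !mulg1 !mulgA mulgK.
by rewrite /= !mulg1 !mulgA mulgKV.
Qed.

End Hurwitz.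

Notation delta m := (tuple_pow [:: s1; s2] m).

Lemma tuple_powS (T : Type) (s : seq T) m : tuple_pow s m.+1 = s ++ tuple_pow s m.
Proof. by []. Qed.

Lemma tuple_powD (T : Type) (s : seq T) m n :
  tuple_pow s (m + n) = tuple_pow s m ++ tuple_pow s n.
Proof. by rewrite /tuple_pow nseqD flatten_cat. Qed.

Lemma size_delta m : size (delta m) = (2 * m)%N.
Proof. by elim: m => // m IHm; rewrite tuple_powS size_cat IHm mulnS. Qed.

Lemma prod_delta m : \prod_(a <- delta m) a = rho ^+ m.
Proof.
elim: m => [|m IHm]; first by rewrite big_nil.
by rewrite tuple_powS big_cat !big_cons big_nil IHm /= mulg1 expgS rho.unlock.
Qed.

(** Each right move past an entry conjugates by it, and [s1 * s2] is [rho]. *)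
Lemma hurwitz_past_delta a m :
  hurwitz_reach (a :: delta m) (delta m ++ [:: a ^ (rho ^+ m)]).
Proof.
elim: m a => [|m IHm] a; first by rewrite conjg1; apply: rt_refl.
have step : hurwitz_reach [:: a; s1; s2] [:: s1; s2; a ^ rho].
  apply: hurwitz_trans (hurwitz_catr [:: s2] (hurwitz_right a s1)) _.
  rewrite rho.unlock conjgM.
  exact: (hurwitz_catl [:: s1] (hurwitz_right (a ^ s1) s2)).
apply: hurwitz_trans (hurwitz_catr (delta m) step) _.
by rewrite expgS conjgM; apply: (hurwitz_catl [:: s1; s2] (IHm _)).
Qed.

(** A right move lowers c by one, down to the pair ([s1], [s2]) at c = 1. The case c = 0 coincides
    with c = 3, because [rho ^+ 3] is central. *)
Lemma hurwitz_delta_pair c :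
  hurwitz_reach [:: s0 ^ (rho ^+ c.+1); s0 ^ (rho ^+ c)] [:: s1; s2].
Proof.
suff from1 k :
    hurwitz_reach [:: s0 ^ (rho ^+ k.+2); s0 ^ (rho ^+ k.+1)] [:: s1; s2].
  case: c => [|c]; last exact: from1.
  have := from1 2.
  rewrite (_ : s0 ^ (rho ^+ 4) = s0 ^ (rho ^+ 1)).
    by rewrite (_ : s0 ^ (rho ^+ 3) = s0 ^ (rho ^+ 0)) // rho3 -[z]mulg1 conj_z.
  by rewrite expgS rho3 -zC conj_z.
elim: k => [|k IHk]; first by rewrite s0_rho2 expg1 s0_rho; apply: rt_refl.
apply: hurwitz_trans (hurwitz_right _ _) _.
rewrite (_ : _ ^ (s0 ^ (rho ^+ k.+2)) = s0 ^ (rho ^+ k.+1)) //.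
rewrite -[k.+3]/(2 + k.+1)%N -[k.+2]/(1 + k.+1)%N !expgD.
rewrite 2!(conjgM s0 _ (rho ^+ k.+1)) -conjJg.
rewrite s0_rho2 expg1 s0_rho s0.unlock rho.unlock conjgM; congr (_ ^ _).
by rewrite [s1 ^ s1]conjgE mulKg.
Qed.

(** Here [om] cancels the middle [om] of [s0^-1]; this is the source of every drop of depth by a
    left move. *)
Lemma om_rho_s0V : om * rho * s0^-1 = rho ^+ 2.
Proof.
apply: (mulIg s0); rewrite mulgKV s0E mulgA -zC -mulgA 2!(mulgA (rho ^+ 2)).
by rewrite -expgSr rho3 2!mulgA zz mul1g.
Qed.

Lemma om_rho2_s0 : om * rho ^+ 2 * s0 = z * rho.
Proof.
rewrite s0E mulgA -zC -!(mulgA z) -[om * _ * _]mulgA.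
rewrite 2!(mulgA (rho ^+ 2)) -expgSr rho3.
by rewrite 2!(mulgA om) -zC -(mulgA z om om) -z.unlock zz mul1g.
Qed.

Lemma cval_base : cval (0%R, None) = s0.
Proof. by rewrite /cval /cf expg0 conjg1. Qed.

(** Moving [(cval x)^-1] to the left of [cf x] turns it into [s0^-1], so [om_rho_s0V] shortens the
    conjugator to [wd Y * rho ^+ 2 * cf x], with one [om] fewer. *)
Lemma reduce_left x y Y : cval y = s0 ^ (wd Y * om * rho * cf x) ->
    depth y = (size Y + depth x).+1 ->
  exists2 t, cval t = cval y ^ (cval x)^-1 & (depth t < depth y)%N.
Proof.
move=> yE ->.
have bnd : conj_bound (size Y + 0 + depth x) (wd Y * rho ^+ 2 * cf x).
  apply: conj_boundM (conj_bound_cf x).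
  by apply: conj_boundM; [apply: conj_bound_wd | apply: conj_bound_rho].
have [t tE le_t] := bnd (0%R, None); exists t;
  last by move: le_t; rewrite /depth /=; lia.
rewrite tE yE cval_base -conjgM /cval -conjVg [s0^-1 ^ _]conjgE.
congr (s0 ^ _); rewrite -om_rho_s0V !mulgA mulgK //.
Qed.

(** Mirror image of [reduce_left], with [om_rho2_s0] as the cancellation; the central [z] it leaves
    is harmless. *)
Lemma reduce_right x y X : cval x = s0 ^ (wd X * om * rho ^+ 2 * cf y) ->
    depth x = (size X + depth y).+1 ->
  exists2 t, cval t = cval x ^ (cval y) & (depth t < depth x)%N.
Proof.
move=> xE ->.
have bnd : conj_bound (size X + 0 + depth y) (wd X * rho ^+ 1 * cf y).
  apply: conj_boundM (conj_bound_cf y).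
  by apply: conj_boundM; [apply: conj_bound_wd | apply: conj_bound_rho].
have [t tE le_t] := bnd (0%R, None); exists t;
  last by move: le_t; rewrite /depth /=; lia.
rewrite tE xE cval_base expg1 -conjgM [cval y]/cval [s0 ^ cf y]conjgE.
rewrite -[_ * cf y * _]mulgA mulKVg (mulgA (_ * rho ^+ 2)) -(mulgA _ om).
rewrite -[_ * _ * s0]mulgA om_rho2_s0.
by rewrite (mulgA (wd X) z) -[_ * z * rho * _]mulgA conj_zl mulgA.
Qed.

(** * Reduction of adjacent pairs *)

Lemma Z3P (c : 'Z_3) : [\/ c = 0%R, c = 1%R | c = 2%:R%R].
Proof.
by case: c => [[|[|[|//]]] ?];
  [apply: Or31|apply: Or32|apply: Or33]; apply/val_inj.
Qed.

Lemma sector_rhoZ (c : 'Z_3) E : sector (rho ^+ c * E) = (sector E + c)%R.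
Proof. by rewrite sector_rhoX natr_Zp. Qed.

(** Ping-pong: in each syllable the power of [rho] moves arc 0 off itself and [om] brings it
    back. *)
Lemma sector_wd X E : sector E = 0%R -> sector (wd X * E) = 0%R.
Proof.
elim: X E => [|a X IHX] E E0; first by rewrite mul1g.
rewrite /= -!mulgA IHX // sector_om_neq0 // sector_rhoX E0 add0r.
by case: a.
Qed.

Lemma sector_wd_om X E : sector (wd X * (om * E)) = 1%R -> sector E = 0%R.
Proof.
move=> XE; apply: sector_omK; apply/eqP => /(sector_wd X).
by rewrite XE.
Qed.

Lemma sector_wd_cons (a : bool) X E :
  sector (wd (a :: X) * E) = 1%R -> (sector E + a.+1%:R = 0)%R.
Proof. by rewrite /= -!mulgA => /sector_wd_om; rewrite sector_rhoX. Qed.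

Lemma sector_wd_cons0 (a : bool) X E :
  (sector E + a.+1%:R != 0)%R -> sector (wd (a :: X) * E) = 0%R.
Proof.
by move=> ?; rewrite /= -!mulgA sector_wd // sector_om_neq0 // sector_rhoX.
Qed.

(* Let J(x) be the arc of the E with sector (cf x * E) = 1.  Since s0 maps
   sectors 0 and 1 into sector 1, this says that cval x maps J(y) into J(x). *)
Definition good_pair (x y : code) : Prop :=
  forall E, sector (cf y * E) = 1%R -> sector (cf x * E) <> 2%:R%R.

(** In the reducible cases one conjugator ends in the other, preceded by the letters that cancel the
    middle [om] of [s0]. The equations concern values because conjugators matter only up to the
    centre. *)
Variant pair_spec (x y : code) : Prop :=
  | GoodPair of good_pair x y
  | ReducibleLeft Y of cval y = s0 ^ (wd Y * om * rho * cf x)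
      & depth y = (size Y + depth x).+1
  | ReducibleRight X of cval x = s0 ^ (wd X * om * rho ^+ 2 * cf y)
      & depth x = (size X + depth y).+1
  | DeltaPair c of cval x = s0 ^ (rho ^+ c.+1) & cval y = s0 ^ (rho ^+ c).

(** Common rightmost syllables are stripped. Distinct next syllables require E in distinct arcs; if
    one word has ended, the next syllable of the other decides between a good pair and a
    cancellation. *)
Lemma wd_pair X Y :
  [\/ forall E, sector (wd Y * E) = 1%R -> sector (wd X * E) <> 2%:R%R,
      exists Z, Y = X ++ false :: Z | exists Z, X = Y ++ true :: Z].
Proof.
elim: X Y => [|a X IHX] [|b Y].
- by apply: Or31 => E; rewrite mul1g => ->.
- case: b; last by apply: Or32; exists Y.
  apply: Or31 => E /sector_wd_cons + E2; rewrite mul1g in E2.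
  by rewrite E2.
- case: a; first by apply: Or33; exists X.
  by apply: Or31 => E; rewrite mul1g => E1; rewrite sector_wd_cons0 ?E1.
- have [<-{b}|ab] := eqVneq a b.
    case: (IHX Y) => [gd|[Z ->]|[Z ->]].
    + by apply: Or31 => E; rewrite /= -!(mulgA (wd _)); apply: gd.
    + by apply: Or32; exists Z.
    + by apply: Or33; exists Z.
  apply: Or31 => E /sector_wd_cons/eqP; rewrite addr_eq0 => /eqP E1.
  by rewrite sector_wd_cons0 // E1; case: a b {E1} ab => [] [].
Qed.

Lemma conj_rho_shift (A : SL2Z) (c : 'Z_3) n :
  s0 ^ (A * rho ^+ (c + n%:R)%R) = s0 ^ (A * rho ^+ n * rho ^+ c).
Proof.
by have := conj_Zp3 s0 A 1 c n; rewrite !mulg1 -!mulgA -!expgD [n + c]addnC.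
Qed.

(** For two codes of positive depth, distinct final powers of [rho] separate the arcs, and equal
    ones reduce to [wd_pair]. If a depth is 0, the remaining cases form a finite table over Z/3. *)
Lemma pairP x y : pair_spec x y.
Proof.
case: x => c [X|]; case: y => c' [Y|].
- have [<-{c'}|cc'] := eqVneq c c'.
    case: (wd_pair X Y) => [gd|[Z ->]|[Z ->]].
    + apply: GoodPair => E.
      by rewrite /cf /= -!(mulgA (wd _)) -!(mulgA om); apply: gd.
    + apply: (@ReducibleLeft _ _ Z); rewrite /depth /= ?size_cat /=; last by lia.
      by rewrite /cval /cf /= wd_cat /= expg1 !mulgA.
    + apply: (@ReducibleRight _ _ Z); rewrite /depth /= ?size_cat /=; last by lia.
      by rewrite /cval /cf /= wd_cat /= !mulgA.
  apply: GoodPair => E; rewrite /cf /= -!(mulgA (wd _)) -!(mulgA om) => secY.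
  rewrite sector_wd // sector_om_neq0 // sector_rhoZ.
  move/sector_wd_om: secY.
  rewrite sector_rhoZ => /eqP; rewrite addr_eq0 => /eqP ->.
  by rewrite addrC subr_eq0.
- have [cc'|cc'] := eqVneq c (c' + 2%:R)%R.
    apply: (@ReducibleRight _ _ X); last by rewrite /depth /= addn0.
    rewrite /cval /cf cc'.
    exact: conj_rho_shift.
  apply: GoodPair => E.
  rewrite /cf /= -!(mulgA (wd _)) -!(mulgA om) sector_rhoZ => secE.
  rewrite sector_wd // sector_om_neq0 // sector_rhoZ.
  move: cc' secE.
  by case: (Z3P (sector E)) => ->; case: (Z3P c) => ->; case: (Z3P c') => ->.
- have [cc'|cc'] := eqVneq c' (c + 1%:R)%R.
    apply: (@ReducibleLeft _ _ Y); last by rewrite /depth /= addn0.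
    rewrite /cval /cf cc'.
    by rewrite -[rho in RHS]expg1; apply: conj_rho_shift.
  apply: GoodPair => E.
  rewrite /cf /= -!(mulgA (wd _)) -!(mulgA om) => secY secE.
  move/sector_wd_om: secY.
  move: cc' secE; rewrite !sector_rhoZ.
  by case: (Z3P (sector E)) => ->; case: (Z3P c) => ->; case: (Z3P c') => ->.
- have [cc'|cc'] := eqVneq c (c' + 1%:R)%R.
    apply: (@DeltaPair _ _ c') => //; rewrite /cval /cf cc'.
    by have := conj_Zp3 s0 1 1 c' 1; rewrite !mul1g !mulg1 expg1 -expgSr.
  apply: GoodPair => E; rewrite /cf /= !sector_rhoZ => secY secX.
  move: cc' secY secX.
  by case: (Z3P (sector E)) => ->; case: (Z3P c) => ->; case: (Z3P c') => ->.
Qed.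

(** The extra one per entry makes the measure drop also when a pair is split off as ([s1], [s2]). *)
Definition measure (xs : seq code) : nat := \sum_(x <- xs) (depth x).+1.

Fixpoint good (xs : seq code) : Prop :=
  if xs is x :: r then (if r is y :: _ then good_pair x y else True) /\ good r
  else True.

Lemma reduce_step xs : good xs \/ exists m ys,
  (measure ys < measure xs)%N /\
  hurwitz_reach (map cval xs) (delta m ++ map cval ys).
Proof.
elim: xs => [|x [|y r] IH]; [by left | by left |].
case: (pairP x y) => [gd|Y yE yd|X xE xd|c xE yE].
- case: IH => [gr|[m [ys [lt_ys rys]]]]; first by left.
  (* The tail has released m pairs ([s1], [s2]); carrying x past them conjugates it by [rho ^+ m],
     which does not raise its depth. *)
  right; have [t tE td] := conj_bound_rho m x; exists m, (t :: ys); split.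
    by move: lt_ys; rewrite /measure !big_cons; lia.
  apply: hurwitz_trans (hurwitz_catl [:: cval x] rys) _.
  have := hurwitz_catr (map cval ys) (hurwitz_past_delta (cval x) m).
  by rewrite -catA /= tE.
- have [t tE td] := reduce_left yE yd; right; exists 0%N, [:: t, x & r]; split.
    by rewrite /measure !big_cons; lia.
  by rewrite /= tE; apply: (hurwitz_catr (map cval r)) (hurwitz_left _ _).
- have [t tE td] := reduce_right xE xd; right; exists 0%N, [:: y, t & r]; split.
    by rewrite /measure !big_cons; lia.
  by rewrite /= tE; apply: (hurwitz_catr (map cval r)) (hurwitz_right _ _).
- right; exists 1%N, r; split; first by rewrite /measure !big_cons; lia.
  rewrite /= xE yE.
  exact: (hurwitz_catr (map cval r)) (hurwitz_delta_pair c).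
Qed.

Lemma reduce xs : exists m ys,
  good ys /\ hurwitz_reach (map cval xs) (delta m ++ map cval ys).
Proof.
have [n] := ubnP (measure xs); elim: n xs => // n IHn xs lt_n.
case: (reduce_step xs) => [gd|[m [ys [lt_ys rys]]]].
  by exists 0, xs; split=> //; apply: rt_refl.
have [|m' [ts [gt rts]]] := IHn ys; first exact: leq_trans lt_ys _.
exists (m + m')%N, ts; split=> //; apply: hurwitz_trans rys _.
by rewrite tuple_powD -catA; apply: hurwitz_catl.
Qed.

(** * Ping-pong and the theorem *)

Lemma sector_s0 E : sector E <> 2%:R%R -> sector (s0 * E) = 1%R.
Proof.
move=> E2; rewrite s0E -mulgA sector_z -2!mulgA sector_rho sector_om_neq0 ?add0r //.
by rewrite sector_rho; move: E2; case: (Z3P (sector E)) => ->.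
Qed.

Lemma cf_cval x E : cf x * (cval x * E) = s0 * (cf x * E).
Proof. by rewrite /cval conjgE !mulgA mulgV mul1g. Qed.

(** The last entry sends everything outside one arc c into its own arc J, and each good pair carries
    J of the right code into J of the left one. *)
Lemma good_prod x r : good (x :: r) -> exists c, forall E, sector E <> c ->
  sector (cf x * (\prod_(y <- x :: r) cval y * E)) = 1%R.
Proof.
elim: r x => [|y r IHr] x /=.
  move=> _; rewrite big_seq1.
  (* At positive depth, off the arc -c the factor [rho ^+ c] avoids arc 0, so [om] and then [wd] end
     in arc 0. At depth 0 the excluded arc is the preimage of arc 2. *)
  have [c cP] : exists c, forall E, sector E <> c -> sector (cf x * E) <> 2%:R%R.
    case: x => c [X|]; rewrite /cf /=.
      exists (- c)%R => E /eqP Ec; rewrite -!mulgA sector_wd //.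
      by rewrite sector_om_neq0 // sector_rhoZ addr_eq0.
    exists (2%:R - c)%R => E Ec; rewrite sector_rhoZ => Ec2; apply: Ec.
    by rewrite -Ec2 addrK.
  by exists c => E /cP Ec; rewrite cf_cval sector_s0.
case=> gxy /IHr[c cP]; exists c => E /cP Ec.
by rewrite big_cons -mulgA cf_cval sector_s0 //; apply: gxy.
Qed.

Lemma sector_zX A e E : sector (A * (z ^+ e * E)) = sector (A * E).
Proof.
elim: e => [|e IHe]; first by rewrite mul1g.
by rewrite expgS -(mulgA z) (mulgA A) -zC -mulgA sector_z.
Qed.

Lemma sector_rhoX_mod A m n E : m = n %[mod 3] ->
  sector (A * (rho ^+ m * E)) = sector (A * (rho ^+ n * E)).
Proof.
suff red k : sector (A * (rho ^+ k * E)) = sector (A * (rho ^+ (k %% 3) * E)).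
  by move=> mn; rewrite red mn -red.
by rewrite {1}(divn_eq k 3) expgD mulnC expgM rho3 -mulgA sector_zX.
Qed.

Lemma sector_s1XS k : sector (s1 ^+ k.+1) = 2%:R%R.
Proof. by rewrite -[s1 ^+ _]mulg1 sector_s1X // sector_1. Qed.

Lemma om_rho_s1 E : om * (rho ^+ 1 * (s1 * E)) = z * E.
Proof.
rewrite expg1 2!mulgA; congr (_ * E); apply/SL2_mx_inj.
by rewrite !(mx_z, mx_rho, mx_om, SL2_mx_mul) /= !mx22_mul.
Qed.

(** For k > 0 both powers lie in arc 2, which forces the head syllable [om * rho]; it cancels one
    [s1] from each, and induction applies. For k = 0 they lie in distinct arcs, while a head
    syllable admits only one. *)
Lemma wd_s1X X k :
  sector (wd X * s1 ^+ k) = 1%R -> sector (wd X * s1 ^+ k.+1) <> 1%R.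
Proof.
elim: X k => [|a X IHX] k; first by rewrite !mul1g sector_s1XS.
case: k => [|k] sec1 sec2.
  have := sector_wd_cons sec1; have := sector_wd_cons sec2.
  by rewrite sector_s1XS sector_1; case: a {sec1 sec2}.
have := sector_wd_cons sec1; rewrite sector_s1XS.
case: a sec1 sec2 => // sec1 sec2 _; apply: (IHX k).
  move: sec1; rewrite /= -2!mulgA (expgS _ k) om_rho_s1.
  by rewrite mulgA -zC -mulgA sector_z.
move: sec2; rewrite /= -2!mulgA (expgS _ k.+1) om_rho_s1.
by rewrite mulgA -zC -mulgA sector_z.
Qed.

Lemma Z3_natr (m n : nat) : (m%:R = n%:R :> 'Z_3)%R -> m = n %[mod 3].
Proof. by move/(congr1 (fun c : 'Z_3 => c : nat)); rewrite !val_Zp_nat. Qed.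

(* Evaluating the product at f, h and e (the columns of 1, s1 and om) locates
   the arc J(x). *)
Lemma good_head x r m e k : good (x :: r) ->
    rho ^+ m * \prod_(y <- x :: r) cval y = z ^+ e * s1 ^+ k ->
  (0 < k)%N /\ cval x = s1 ^ (rho ^+ m).
Proof.
move=> /good_prod[c]; set P := \prod_(y <- _) _ => cP prodE.
have rhoP E : rho ^+ m * (P * E) = z ^+ e * (s1 ^+ k * E).
  by rewrite !mulgA prodE.
(* [tau] is the arc containing J(x). *)
pose tau := (match x.2 with Some _ => - x.1 | None => 1 - x.1 end)%R.
have topE E : sector E != c -> sector (s1 ^+ k * E) = (tau + m%:R)%R.
  move=> /eqP/cP secE; transitivity (sector (rho ^+ m * (P * E))).
    by rewrite rhoP -[z ^+ e * _]mul1g sector_zX mul1g.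
  rewrite sector_rhoX; congr (_ + _)%R; move: secE; rewrite /cf /tau.
  case: x.2 => [X|].
    rewrite -2!mulgA => /sector_wd_om; rewrite sector_rhoZ => /eqP.
    by rewrite addr_eq0 => /eqP.
  by rewrite sector_rhoZ => <-; rewrite addrK.
have sec_om : sector om = 0%R by have := sector_s1X_om 0; rewrite mul1g.
have sec_s1 : sector s1 = 2%:R%R := sector_s1XS 0.
case: k prodE rhoP topE => [|k] prodE rhoP topE.
  (* The sectors of [1], [s1] and [om] are distinct, so two of them avoid c, yet [topE] makes those
     two equal. *)
  have t1 := topE 1; have t2 := topE s1; have t0 := topE om; exfalso.
  move: t0 t1 t2; rewrite expg0 !mul1g sector_1 sec_om sec_s1.
  case: (Z3P c) => -> t0 t1 t2.
  - by have := t2 isT; rewrite -t1.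
  - by have := t2 isT; rewrite -t0.
  - by have := t1 isT; rewrite -t0.
split=> //.
(* One of [1] and [s1] avoids c, and a positive power of [s1] sends it into arc 2. *)
have tau2 : (tau + m%:R = 2%:R)%R.
  case: (Z3P c) => cE.
  - by rewrite -(topE 1) ?mulg1 ?sector_s1XS // sector_1 cE.
  - by rewrite -(topE s1) ?sector_s1X ?sec_s1 // cE.
  - by rewrite -(topE 1) ?mulg1 ?sector_s1XS // sector_1 cE.
(* Otherwise [om] avoids c, but powers of [s1] keep it in arc 0. *)
have c0 : c = 0%R.
  apply/eqP/negPn/negP => c0; have := topE om.
  by rewrite sector_s1X_om tau2 sec_om eq_sym c0 => /(_ isT).
have [o xE] : exists o, x = (x.1, o) by exists x.2; case: (x).
rewrite /tau xE /= in tau2.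
case: o xE tau2 => [X|] xE tau2; last first.
  rewrite xE /cval /cf /=.
  rewrite -s0_rho2 -conjgM -expgD; have := @conj_rhoX s0 1 1 x.1 (2 + m).
  rewrite !mul1g !mulg1; apply; apply: Z3_natr.
  rewrite natr_Zp natrD; apply/eqP; move: tau2.
  by case: (Z3P x.1) => ->; case: (Z3P m%:R%R) => ->.
(* Positive depth is refuted here: [x.1] is 1 + m modulo 3, so the trailing [om * rho] cancels one
   [s1] and leaves [wd X * s1 ^+ k]. Taking E to be [1] and [s1] contradicts [wd_s1X]. *)
have key E : sector E != 0%R -> sector (wd X * (s1 ^+ k * E)) = 1%R.
  rewrite -c0 => /eqP/cP; rewrite {1}xE /cf /= -!(mulgA (wd X * om)).
  have xm : x.1 = 1 + m %[mod 3].
    apply: Z3_natr; rewrite natr_Zp natrD; apply/eqP; move: tau2.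
    by case: (Z3P x.1) => ->; case: (Z3P m%:R%R) => ->.
  rewrite (sector_rhoX_mod _ _ xm) expgD -(mulgA (rho ^+ 1)) rhoP.
  rewrite (mulgA (wd X * om)) sector_zX (expgS s1) -(mulgA s1).
  rewrite -(mulgA _ (rho ^+ 1)) -(mulgA _ om) om_rho_s1.
  by rewrite mulgA -zC -mulgA sector_z.
have := key 1; rewrite mulg1 sector_1 => /(_ isT)/wd_s1X; case.
by rewrite expgSr; apply: key; rewrite sec_s1.
Qed.

(** By [good_head], [rho ^+ m * cval x] is [s1 * rho ^+ m], so one [s1] cancels on both sides. At
    the end [rho ^+ m] proves central, hence each entry is [s1] itself. *)
Lemma good_s1X ys m e k : good ys ->
    rho ^+ m * \prod_(y <- ys) cval y = z ^+ e * s1 ^+ k ->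
  rho ^+ m = z ^+ e /\ map cval ys = nseq k s1.
Proof.
elim: ys k => [|x r IHr] k gd.
  rewrite big_nil mulg1; case: k => [|k] prodE; first by rewrite prodE mulg1.
  (* A positive power of [s1] sends both [1] and [s1] into arc 2, whereas [rho ^+ m] permutes the
     arcs. *)
  have secE E : sector E != 0%R -> (sector E + m%:R = 2%:R)%R.
    move=> E0; rewrite -sector_rhoX prodE -mulgA -[_ * _]mul1g sector_zX.
    by rewrite mul1g sector_s1X.
  have := secE s1; have := secE 1.
  rewrite sector_1 (sector_s1XS 0) => /(_ isT) + /(_ isT).
  by case: (Z3P m%:R%R) => ->.
move=> prodE; have [k0 xE] := good_head gd prodE.
case: k k0 prodE => // k _; rewrite big_cons mulgA xE.
have zX : commute (z ^+ e) s1 by apply/commute_sym/commuteX/commute_sym/zC.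
rewrite [s1 ^ _]conjgE mulKVg -mulgA expgS (mulgA (z ^+ e)).
rewrite zX -(mulgA s1) => /mulgI.
case: gd => _ /IHr{}IHr /IHr[rhoE mapE]; split=> //=.
rewrite mapE xE rhoE conjgE; congr (_ :: _).
by rewrite -zX mulKg.
Qed.

Lemma rhoX_eq_zX m (e : bool) :
  rho ^+ m = z ^+ e -> exists p, m = (6 * p + 3 * e)%N.
Proof.
move=> mE; have m3 : m %% 3 = 0.
  have /Z3_natr : (m%:R = 0%:R :> 'Z_3)%R; last by rewrite mod0n.
  have : (sector 1%g + m%:R = 1 + 0)%R.
    by rewrite -sector_rhoX mE -[_ * 1]mul1g sector_zX mul1g sector_1 addr0.
  by rewrite sector_1 => /addrI.
have zq q : z ^+ q = z ^+ odd q.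
  rewrite -{1}[q]odd_double_half expgD -mul2n expgM (expgS _ 1) expg1 zz.
  by rewrite expg1n mulg1.
move: mE; rewrite {1}(divn_eq m 3) m3 addn0 mulnC expgM rho3.
rewrite (zq (m %/ 3)) => oddE.
exists (m %/ 3)./2; suff /esym odde : odd (m %/ 3) = e.
  by rewrite odde; lia.
by move: oddE z_neq1; case: (odd _) e => [] [] // /eqP; rewrite ?(eq_sym 1) => ->.
Qed.

Lemma tuple_pow1 (T : Type) (x : T) k : tuple_pow [:: x] k = nseq k x.
Proof. by elim: k => // k IHk; rewrite tuple_powS IHk. Qed.

(** Since [(s1 * s2) ^+ 3] is [z], the flag [e] treats both halves of the theorem together. The size
    formula follows because moves preserve length. *)
Lemma hurwitz_normal_form (g : seq SL2Z) (k : nat) (e : bool) :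
    (forall a, a \in g -> conjugate_of a s1) ->
    \prod_(a <- g) a = z ^+ e * s1 ^+ k ->
  exists2 p, size g = (12 * p + 6 * e + k)%N &
    hurwitz_reach g (delta (6 * p + 3 * e) ++ tuple_pow [:: s1] k).
Proof.
move=> conj_g prod_g.
have [xs xsE] : exists xs, map cval xs = g.
  elim: g conj_g {prod_g} => [|a g IHg] conj_g; first by exists [::].
  have [x <-] := cval_surj (conj_g a (mem_head a g)).
  have [|xs <-] := IHg; last by exists (x :: xs).
  by move=> b bg; apply: conj_g; rewrite in_cons bg orbT.
have [m [ys [good_ys]]] := reduce xs; rewrite xsE => reach.
have := hurwitz_prod reach; rewrite prod_g big_cat prod_delta big_map /=.
move=> /esym/(good_s1X good_ys)[/rhoX_eq_zX[p mE] ysE].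
exists p; last by rewrite -mE tuple_pow1 -ysE.
by rewrite (hurwitz_size reach) size_cat size_delta ysE size_nseq mE; lia.
Qed.

Theorem theorem5 (k n : nat) (g : n.-tuple SL2Z)
    (hg : forall i : 'I_n, conjugate_of (tnth g i) s1) :
  ((\prod_(i < n) tnth g i = s1 ^+ k)%g ->
    exists p : nat,
      ((n%:R - k%:R) / 12%:R = p%:R :> rat)%R /\
      hurwitz_reach g (tuple_pow [:: s1; s2] (6 * p) ++ tuple_pow [:: s1] k))
  /\
  ((\prod_(i < n) tnth g i = (s1 * s2) ^+ 3 * s1 ^+ k)%g ->
    exists p : nat,
      ((n%:R - 6%:R - k%:R) / 12%:R = p%:R :> rat)%R /\
      hurwitz_reach g
        (tuple_pow [:: s1; s2] (6 * p + 3) ++ tuple_pow [:: s1] k)).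
Proof.
have conj_g a : a \in tval g -> conjugate_of a s1.
  by move=> /tnthP[i ->].
rewrite -(big_tuple _ _ g predT id) -rho.unlock rho3; split=> prod_g.
  have [|p sz reach] := @hurwitz_normal_form g k false conj_g.
    by rewrite expg0 mul1g.
  exists p; split; last by rewrite muln0 addn0 in reach.
  move: sz; rewrite size_tuple => ->.
  by rewrite muln0 addn0 natrD addrK natrM mulrC mulKf.
have [|p sz reach] := @hurwitz_normal_form g k true conj_g.
  by rewrite expg1.
exists p; split; last by [].
move: sz; rewrite size_tuple => ->.
by rewrite muln1 natrD addrAC addrK natrD addrK natrM mulrC mulKf.
Qed.
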